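(* We have $\alpha_2(2) = 0$. For every even integer $k > 2$, we have $\alpha_k(2) = 2$ if $k$ is divisible by $6$, and $\alpha_k(2) = 1$ otherwise. Here, for an even positive integer $k$, $\alpha_k(2) = v_2(m(k)) - v_2(k)$, where $m(k)$ is the minimum positive integer $m$ such that $mx$ is an integer linear combination of $k$th powers of elements of $\mathbb{Z}[x]$.
   Context: For a positive integer $k$ and a ring $R$, $J(k,R)$ denotes the additive subgroup of $R$ generated by the $k$th powers of elements of $R$; $G(k,R) \subseteq \mathbb{Z}$ is the additive subgroup of integers $m$ with $mR \subseteq J(k,R)$; and $m(k,R) \ge 0$ is the unique nonnegative integer with $G(k,R) = m(k,R)\mathbb{Z}$. Put $m(k) = m(k,\mathbb{Z}[x])$. Equivalently, $m(k)$ is the minimum positive integer $m$ such that $mx \in J(k,\mathbb{Z}[x])$ (such an integer exists). One has $k \mid m(k)$ and $m(k) \mid k!$, so one may write $$m(k) = k\cdot \prod_{p\mid k} p^{\alpha_k(p)} \cdot \prod_{p < k,\ p \nmid k} p^{\beta_k(p)}$$ with nonnegative integers $\alpha_k(p)$, $\beta_k(p)$, the products being over primes $p$. Thus for $k$ even, $\alpha_k(2) = v_2(m(k)) - v_2(k)$, where $v_2$ denotes the $2$-adic valuation. *)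

(* Defs.v *)
From mathcomp Require Import all_boot all_order all_algebra.
From mathcomp Require Import boolp.

Set Implicit Arguments.
Unset Strict Implicit.
Unset Printing Implicit Defensive.

Import Order.TTheory GRing.Theory Num.Theory.
Local Open Scope ring_scope.

(* J(k, R): the subgroup generated by the kth powers, given as the set of their
   finite integer linear combinations; see in_JP for the agreement with the
   intersection of all additive subgroups containing the kth powers. *)
Definition in_J (k : nat) (R : nzRingType) (a : R) : Prop :=
  exists s : seq (int * R), a = \sum_(c <- s) (c.2 ^+ k) *~ c.1.

Definition kills_X (k m : nat) : Prop :=
  (0 < m)%N /\ in_J k ('X *+ m : {poly int}).

(* m(k) = m(k, Z[x]).  The default branch is only reached for k = 0, by
   kills_X_exists. *)
Definition mk (k : nat) : nat :=
  match pselect (exists m, `[< kills_X k m >]) with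
  | left ex_m => ex_minn ex_m
  | right _ => 0
  end.

(* Meant for p a prime divisor of k; int-valued, so that the difference is not
   truncated. *)
Definition alpha (k p : nat) : int :=
  (logn p (mk k))%:Z - (logn p k)%:Z.

Lemma in_J_zmod (k : nat) (R : nzRingType) :
  in_J k (0 : R) /\
  (forall a b : R, in_J k a -> in_J k b -> in_J k (a - b)).
Proof.
split; first by exists [::]; rewrite big_nil.
move=> _ _ [s ->] [t ->].
exists (s ++ [seq (- c.1, c.2) | c <- t]).
rewrite big_cat big_map /= -sumrN; congr (_ + _).
by apply: eq_bigr => c _; rewrite mulrNz.
Qed.

Lemma in_J_pow (k : nat) (R : nzRingType) (a : R) : in_J k (a ^+ k).
Proof. by exists [:: (1, a)]; rewrite big_seq1. Qed.

Lemma in_JP (k : nat) (R : nzRingType) (a : R) :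
  in_J k a <->
  (forall S : R -> Prop, S 0 -> (forall b c, S b -> S c -> S (b - c)) ->
    (forall b, S (b ^+ k)) -> S a).
Proof.
split=> [[s ->] S S0 SB Sk|]; last first.
  by have [J0 JB] := in_J_zmod k R; apply=> // b; exact: in_J_pow.
have SN b : S b -> S (- b) by move=> Sb; rewrite -sub0r; apply: SB.
have SD b c : S b -> S c -> S (b + c).
  by move=> Sb /SN Sc; rewrite -[c]opprK; apply: SB.
apply: (big_ind S) => // -[z b] _ /=.
have Sn n : S ((b ^+ k) *+ n).
  by elim: n => [|n IH]; rewrite ?mulr0n // mulrS; apply: SD.
by case: z => n; [exact: Sn | rewrite NegzE mulrNz; apply: SN; exact: Sn].
Qed.

Lemma in_J_comp (k : nat) (p q : {poly int}) : in_J k p -> in_J k (p \Po q).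
Proof.
move=> [s ->]; exists [seq (c.1, c.2 \Po q) | c <- s].
rewrite big_map raddf_sum /=; apply: eq_bigr => c _.
by rewrite raddfMz /= rmorphXn.
Qed.

Lemma in_J_diff (k n : nat) : (n <= k)%N ->
  exists p : {poly int}, [/\ in_J k p, (size p <= (k - n).+1)%N
                           & p`_(k - n) = (k ^_ n)%:R].
Proof.
elim: n => [_|n IH ltnk].
  exists 'X^k; split; first exact: in_J_pow.
    by rewrite size_polyXn subn0.
  by rewrite subn0 coefXn eqxx.
have [p [Jp sp cp]] := IH (ltnW ltnk).
have e : (k - n = (k - n.+1).+1)%N by rewrite -subSn.
move: sp cp; rewrite e; set d := (k - n.+1)%N => sp cp.
have coefE i : (p \Po ('X + 1))`_i = \sum_(j < d.+2) p`_j *+ 'C(j, i).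
  rewrite comp_polyE coef_sum.
  rewrite (big_ord_widen _ (fun j => (p`_j *: ('X + 1) ^+ j)`_i) sp).
  rewrite [RHS](bigID (fun j : 'I__ => (j < size p)%N)) /=.
  rewrite [X in _ = _ + X]big1 ?addr0 => [|j].
    apply: eq_bigr => j _; rewrite coefZ (addrC (polyX _)) exprDn coef_sum.
    under eq_bigr => l _ do
      rewrite expr1n mul1r coefMn coefXn.
    have [lij|lji] := ltnP i j.+1.
      rewrite (bigD1 (Ordinal lij)) //= eqxx big1 ?addr0; last first.
        move=> l /eqP nl; case: eqP => [il|]; last by rewrite mul0rn.
        by case: nl; apply: val_inj.
      by rewrite mulr_natr.
    rewrite bin_small // big1 ?mulr0 // => l _.
    case: eqP => [il|_]; last by rewrite mul0rn.
    by have := ltn_ord l; rewrite -il ltnNge lji.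
  by rewrite -leqNgt => h; rewrite nth_default // mul0rn.
exists (p \Po ('X + 1) - p); split.
- by apply: (in_J_zmod k _).2 => //; exact: in_J_comp.
- apply/leq_sizeP => i di; rewrite coefB coefE !big_ord_recr /= big1 => [|j _].
    rewrite add0r (@bin_small d i) // mulr0n add0r.
    move: di; rewrite leq_eqVlt => /orP[/eqP <-|di].
      by rewrite binn subrr.
    by rewrite bin_small // (nth_default _ (leq_trans sp di)) subrr.
  by rewrite bin_small // (leq_trans (ltn_ord j)) // ltnW.
- rewrite coefB coefE !big_ord_recr /= big1 => [|j _]; last by rewrite bin_small.
  rewrite add0r binn binSn addrAC subrr add0r cp ffactnSr natrM e.
  by rewrite mulr_natr.
Qed.

Lemma kills_X_fact (k : nat) : (0 < k)%N -> kills_X k k`!.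
Proof.
case: k => // k _; split; first exact: fact_gt0.
have [p [Jp sp cp]] := in_J_diff (leqnSn k).
move: sp cp; rewrite subSnn => sp cp.
have -> : 'X *+ k.+1`! = p - (p`_0)%:P.
  apply/polyP => -[|[|i]]; rewrite coefMn coefX coefB coefC /=.
  - by rewrite mul0rn subrr.
  - rewrite subr0 cp; congr (_%:R).
    by rewrite -ffactnn ffactnSr subSnn muln1.
  - by rewrite mul0rn subr0 nth_default // (leq_trans sp).
apply: (in_J_zmod _ _).2 => //; exists [:: (p`_0, 1)].
rewrite big_seq1 /= expr1n.
by rewrite -[in LHS](intz p`_0) rmorph_int.
Qed.

Lemma kills_X_exists (k : nat) : (0 < k)%N -> exists m, `[< kills_X k m >].
Proof. by move=> /kills_X_fact H; exists k`!; apply/asboolP. Qed.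

Lemma mkP (k : nat) : (0 < k)%N ->
  kills_X k (mk k) /\ (forall m, kills_X k m -> (mk k <= m)%N).
Proof.
move=> k0; rewrite /mk; case: pselect => [ex_m|[]]; last exact: kills_X_exists.
case: ex_minnP => m /asboolP Km min_m.
by split=> // m' Km'; apply: min_m; apply/asboolP.
Qed.

(* Main.v *)
Require Import Defs.
From mathcomp Require Import all_boot all_order all_algebra.
From mathcomp Require Import cyclic ring zify.

Set Implicit Arguments.
Unset Strict Implicit.
Unset Printing Implicit Defensive.

Import Order.TTheory GRing.Theory Num.Theory.
Local Open Scope ring_scope.

(* Let k be even and v its 2-adic valuation.

   Lower bounds come from quotients Z[x]/(q) with q monic quadratic.  In Z[i],
   every kth power lies in Z + 2^(v+1) Z[i] when k > 2; in Z[w], with w a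
   primitive cube root of unity, every sixth power lies in Z + 8 Z[w], so that
   every kth power lies in Z + 2^(v+2) Z[w] when 6 divides k.

   Upper bounds: localized at 2, J(k, Z[x]) contains 2^(v+2) Z[x], by expanding
   (1 + 2^j g)^k.  If 3 does not divide k, let H be the set of h in F_2[x] such
   that 2^(v+1) h is in J modulo 2^(v+2).  Expanding (f + 2 g)^k shows that H
   contains f^(k-1) g + f^(k-2) g^2, and it contains all kth powers; in
   particular g = g^2 modulo H.  The quotient of F_2[x] by the largest ideal in
   H has no residue field F_4, and this makes every element congruent modulo H
   to an idempotent of the quotient, which is a kth power. *)

(** * Binomial expansions modulo powers of 2 *)

Lemma exprD_linear (R : comNzRingType) (F T : R) (n : nat) :
  exists W, (F + T) ^+ n.+1 = F ^+ n.+1 + n.+1%:R * F ^+ n * T + T ^+ 2 * W.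
Proof.
elim: n => [|n [W IH]]; first by exists 0; rewrite !expr1 expr0; ring.
exists (n.+1%:R * F ^+ n + (F + T) * W).
rewrite exprS IH !(exprS F) -[n.+2]add1n natrD; ring.
Qed.

(** By repeated squaring: each square doubles the linear term, and the square of the perturbation
    stays negligible because [1 < j] gives 2(j + v) >= j + v + 2. *)
Lemma exprD_pow2 (R : comNzRingType) (F G : R) (j v : nat) : (1 < j)%N ->
  exists W, (F + 2 ^+ j * G) ^+ (2 ^ v) =
    F ^+ (2 ^ v) + 2 ^+ (j + v) * (F ^+ (2 ^ v).-1 * G) + 2 ^+ (j + v).+1 * W.
Proof.
case: j => [|[|j]] // _; elim: v => [|v [W IH]].
  by exists 0; rewrite expn0 expr1 /= addn0 expr0; ring.
have ev : (2 ^ v.+1).-1 = (2 ^ v + (2 ^ v).-1)%N.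
  by rewrite expnS mul2n -addnn -subn1 -addnBA ?expn_gt0 // subn1.
set e := (2 ^ v)%N in IH ev *.
exists ((F ^+ e) * W + 2 ^+ (j + v) * (F ^+ e.-1 * G + 2 * W) ^+ 2).
rewrite ev (exprD F) expnSr -/e exprM IH exprM.
rewrite !addSn addnS !(exprS 2).
set A := F ^+ e; set B := F ^+ e.-1; set C := 2 ^+ (j + v).
ring.
Qed.

(** With n = u' 2^v and u' odd, the u'-th power is taken first; its linear coefficient u' = 2u + 1
    counts as 1, the even excess going into [W]. Then [exprD_pow2] applies. *)
Lemma exprD_mul_pow2 (R : comNzRingType) (F G : R) (j n : nat) :
  (1 < j)%N -> (0 < n)%N ->
  exists W, (F + 2 ^+ j * G) ^+ n =
    F ^+ n + 2 ^+ (j + logn 2 n) * (F ^+ n.-1 * G)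
           + 2 ^+ (j + logn 2 n).+1 * W.
Proof.
move=> j1 n0; set v := logn 2 n.
have [|u' cu def_n] := @pfactor_coprime 2 n _ n0; first by [].
rewrite -/v in def_n; move: cu; rewrite coprime2n => odd_u'.
have {odd_u'} [u eu] : exists u, u' = u.*2.+1.
  by exists u'./2; rewrite -[LHS]odd_double_half odd_u'.
have [W1 E1] := exprD_linear F (2 ^+ j * G) u.*2.
set G1 := u.*2.+1%:R * F ^+ u.*2 * G + 2 ^+ j * (G ^+ 2 * W1).
have {}E1 : (F + 2 ^+ j * G) ^+ u' = F ^+ u' + 2 ^+ j * G1.
  by rewrite eu E1 /G1; ring.
have [W E] := exprD_pow2 (F ^+ u') G1 v j1.
rewrite {1 2}def_n !exprM E1 {}E.
have en : n.-1 = (u' * (2 ^ v).-1 + u.*2)%N.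
  rewrite {1}def_n -[in LHS](@prednK (2 ^ v)) ?expn_gt0 // mulnS {1}eu.
  by rewrite addSn /= addnC.
have eR : u.*2.+1%:R = 2 * u%:R + 1 :> R by rewrite -addn1 natrD -mul2n natrM.
rewrite en (exprD F) exprM /G1 {}eR.
case: j j1 {E1 G1} => [|j] // _.
set A := (F ^+ u') ^+ (2 ^ v).-1.
exists (u%:R * A * F ^+ u.*2 * G + 2 ^+ j * A * G ^+ 2 * W1 + W).
rewrite !addSn !(exprS 2); ring.
Qed.

(** * The subgroup J localized at 2, and the upper bound valid for every k *)

(* Membership in the localization of J(k, Z[x]) at the prime 2. *)
Definition in_J2 (k : nat) (a : {poly int}) : Prop :=
  exists2 c : nat, odd c & in_J k (a *+ c).

Section PowerSums.
Variable k : nat.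

Lemma in_J0 (R : nzRingType) : in_J k (0 : R).
Proof. exact: (in_J_zmod k R).1. Qed.

Lemma in_JB (R : nzRingType) (a b : R) : in_J k a -> in_J k b -> in_J k (a - b).
Proof. exact: (in_J_zmod k R).2. Qed.

Lemma in_JMn (R : nzRingType) (a : R) (n : nat) : in_J k a -> in_J k (a *+ n).
Proof.
move=> Ja; elim: n => [|n IH]; first by rewrite mulr0n; exact: in_J0.
rewrite mulrSr -[a in X in _ + X]opprK; apply: in_JB => //.
by rewrite -sub0r; apply: in_JB => //; exact: in_J0.
Qed.

Lemma in_J_in_J2 a : in_J k a -> in_J2 k a.
Proof. by exists 1. Qed.

Lemma in_J2B a b : in_J2 k a -> in_J2 k b -> in_J2 k (a - b).
Proof.
move=> [c oc Jc] [d od Jd]; exists (c * d)%N; first by rewrite oddM oc.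
rewrite mulrnBl mulrnA mulnC [X in _ - X]mulrnA.
by apply: in_JB; apply: in_JMn.
Qed.

Lemma in_J2D a b : in_J2 k a -> in_J2 k b -> in_J2 k (a + b).
Proof.
move=> Ja Jb; rewrite -[b]opprK; apply: in_J2B => //; rewrite -sub0r.
by apply: in_J2B => //; apply: in_J_in_J2; apply: in_J0.
Qed.

Lemma in_J2Mn a n : in_J2 k a -> in_J2 k (a *+ n).
Proof.
move=> [c oc Jc]; exists c => //; rewrite -mulrnA mulnC mulrnA.
exact: in_JMn.
Qed.

Lemma in_J2X a : in_J2 k (a ^+ k).
Proof. by apply: in_J_in_J2; apply: in_J_pow. Qed.

Hypothesis k_gt0 : (0 < k)%N.
Let v := logn 2 k.

(** Substituting a for x in k! x, which lies in J, gives k! a; N is the 2-adic valuation of k!. *)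
Lemma in_J2_mul_pow2_large : exists N, forall a, in_J2 k (2 ^+ N * a).
Proof.
have [_ Jfact] := kills_X_fact k_gt0.
move: (k`!) (fact_gt0 k) Jfact => m m_gt0 Jm.
have [|c] := @pfactor_coprime 2 m _ m_gt0; first by [].
rewrite coprime2n; move: (logn 2 m) => N oc def_m; exists N => a.
exists c => //; have -> : 2 ^+ N * a *+ c = a *+ m.
  by rewrite def_m -mulr_natl -[RHS]mulr_natl natrM natrX mulrA.
by have := in_J_comp a Jm; rewrite raddfMn /= comp_polyX.
Qed.

(* [(1 + 2^j a)^k - 1] is [2^(v+j) a] modulo [2^(v+j+1)] for [1 < j]: descend
   on [j] from a large power of 2. *)
Lemma in_J2_mul_pow2 a : in_J2 k (2 ^+ v.+2 * a).
Proof.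
have [N JN] := in_J2_mul_pow2_large.
suff {a} H m : forall a, in_J2 k (2 ^+ (v.+2 + (N - m)) * a).
  by have := H N a; rewrite subnn addn0.
elim: m => [|m IH] a.
  by rewrite subn0 exprD -mulrA mulrCA; apply: JN.
have [lt_mN|le_Nm] := ltnP m N; last first.
  by have -> : (N - m.+1 = N - m)%N by lia.
set j := ((N - m.+1).+2)%N.
have [W] := exprD_mul_pow2 1 a (isT : 1 < j)%N k_gt0.
rewrite !expr1n mul1r -/v.
have -> : ((j + v).+1 = v.+2 + (N - m))%N by rewrite /j; lia.
have -> : (j + v)%N = (v.+2 + (N - m.+1))%N by rewrite /j; lia.
move=> E.
have -> : 2 ^+ (v.+2 + (N - m.+1)) * a =
  (1 + 2 ^+ j * a) ^+ k - 1 ^+ k - 2 ^+ (v.+2 + (N - m)) * W.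
  by rewrite E expr1n; ring.
by apply: in_J2B => //; apply: in_J2B; apply: in_J2X.
Qed.

End PowerSums.

(** * Additive subgroups in characteristic 2 that contain the 2n-th powers, with n = k/2 *)

Section CharTwo.
Variables (R : comNzRingType) (n : nat) (H : R -> Prop).
Hypothesis charR : 2%N \in [pchar R].
Hypotheses (n_gt0 : (0 < n)%N) (n3 : ~~ (3 %| n)%N).
Hypothesis HD : forall a b, H a -> H b -> H (a + b).
Hypothesis HX : forall f, H (f ^+ n.*2).
Hypothesis Hlin : forall f g,
  H (f ^+ n.*2.-1 * g + f ^+ n.*2.-2 * g ^+ 2).

Let two0 : 2 = 0 :> R := pcharf0 charR.

Lemma H_frob g : H (g + g ^+ 2).
Proof. by have := Hlin 1 g; rewrite !expr1n !mul1r. Qed.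

Lemma H_congr a b : H (a + b) -> H b -> H a.
Proof.
by move=> Hab Hb; have := HD Hab Hb; rewrite -addrA addrr_pchar2 // addr0.
Qed.

Lemma H_0 : H 0.
Proof. by have := HX 0; rewrite expr0n double_eq0 eqn0Ngt n_gt0. Qed.

(* The largest ideal contained in the additive group [H]. *)
Definition absorbing f := forall g, H (f * g).

Lemma H_absorbing f : absorbing f -> H f.
Proof. by move/(_ 1); rewrite mulr1. Qed.

Lemma absorbing0 : absorbing 0.
Proof. by move=> g; rewrite mul0r; apply: H_0. Qed.

Lemma absorbingD a b : absorbing a -> absorbing b -> absorbing (a + b).
Proof. by move=> Ia Ib g; rewrite mulrDl; apply: HD. Qed.

Lemma absorbingM a b : absorbing a -> absorbing (a * b).
Proof. by move=> Ia g; rewrite -mulrA; apply: Ia. Qed.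

(* With [y = f^(n-1) (f^n + 1) g], [y^2] is the sum of the elements
   [f^(2n-1) g + f^(2n-2) g^2] and [f^(2n-1) g + (f^(2n-1) g)^2] of [H]. *)
Lemma absorbing_pow f : absorbing (f ^+ n.-1 * (f ^+ n + 1)).
Proof.
move=> g; set y := _ * g; apply: (H_congr (b := y ^+ 2)); first exact: H_frob.
have := HD (Hlin f g) (H_frob (f ^+ n.*2.-1 * g)).
rewrite {}/y; case: n n_gt0 => // m _ /=.
rewrite !exprS -mul2n mulnC exprM; set p := f ^+ m.
congr H; apply/eqP; rewrite -subr_eq0; apply/eqP.
rewrite [LHS](_ : _ = 2 * (f * p ^+ 2 * g - f * p ^+ 3 * g ^+ 2)); last first.
  by ring.
by rewrite two0 mul0r.
Qed.

(** Turns an identity in characteristic 2 into one valid in every commutative ring, with the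
    discrepancy 2c made explicit. *)
Lemma eq_mod2 (c a b : R) : a = b + 2 * c -> a = b.
Proof. by rewrite two0 mul0r addr0. Qed.

(* [sigma - 1] for the Frobenius [sigma]; [trsum D] is the partial trace
   [1 + sigma + ... + sigma^(D-1)], and [frobXD D] is [sigma^D - 1]. *)
Definition phi f : R := f ^+ 2 + f.

(* If [phi f] is idempotent modulo the ideal, then [w := f * phi f] satisfies
   [w ^+ 2 + w + phi f = 0], hence [w ^+ 3 = phi f]; as [3] does not divide [n],
   [absorbing_pow] at [w] makes [w] idempotent and so kills [phi f]. *)
Lemma absorbing_phi f : absorbing (phi (phi f)) -> absorbing (phi f).
Proof.
set c := phi f => Ic; pose w := f * c.
have h1 : absorbing (w ^+ 2 + w + c).
  rewrite (_ : _ + c = phi c * (1 + f ^+ 2)); first exact: absorbingM.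
  by apply: (@eq_mod2 (- (c * f ^+ 2))); rewrite /w /c /phi; ring.
have h2 : absorbing (w * c + w).
  rewrite (_ : _ + _ = phi c * f); first exact: absorbingM.
  by rewrite /w /phi; ring.
have h4 : absorbing (w ^+ 4 + w).
  rewrite (_ : _ + w = (w ^+ 2 + w + c) * (w ^+ 2 + w) + (w * c + w) * (w + 1)).
    by apply: absorbingD; apply: absorbingM.
  by apply: (@eq_mod2 (- (w ^+ 3) - w ^+ 2 - w ^+ 2 * c - w * c)); ring.
have h5 j : absorbing (w ^+ (3 * j).+1 + w).
  elim: j => [|j IHj].
    by rewrite expr1 addrr_pchar2 //; exact: absorbing0.
  rewrite (_ : _ + _ = (w ^+ 4 + w) * w ^+ (3 * j) + (w ^+ (3 * j).+1 + w)).
    by apply: absorbingD => //; apply: absorbingM.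
  apply: (@eq_mod2 (- (w * w ^+ (3 * j)))).
  by rewrite mulnS !exprS; ring.
have hn : absorbing (w ^+ n * (w ^+ n + 1)).
  have := absorbingM w (absorbing_pow w).
  rewrite (_ : _ * w = w ^+ n * (w ^+ n + 1)) //.
  by rewrite mulrAC -exprSr prednK.
(* Modulo the ideal, w^n is w or w^2. Since w^4 = w, in both cases [hn] puts w^2 + w in the ideal,
   and [h1] then puts c there. *)
have [e|e] : n = (3 * (n %/ 3)).+1 \/ n = (3 * (n %/ 3)).+2.
- move: n3 (divn_eq n 3) (ltn_pmod n (isT : 0 < 3)%N); rewrite /dvdn.
  by lia.
- have hw : absorbing (w ^+ n + w) by rewrite {1}e.
  rewrite (_ : c = (w ^+ 2 + w + c) + (w ^+ n * (w ^+ n + 1))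
         + (w ^+ n + w) * (w ^+ n + w + 1)).
    by apply: absorbingD; [apply: absorbingD | apply: absorbingM].
  apply: (@eq_mod2 (- (w ^+ n) ^+ 2 - w ^+ n - w ^+ n * w - w ^+ 2 - w)).
  by set p := w ^+ n; ring.
- have hw : absorbing (w ^+ n + w ^+ 2).
    rewrite {1}e exprS (_ : _ + _ = (w ^+ (3 * (n %/ 3)).+1 + w) * w).
      exact: absorbingM.
    by ring.
  rewrite (_ : c = (w ^+ 2 + w + c) + (w ^+ n * (w ^+ n + 1))
         + (w ^+ n + w ^+ 2) * (w ^+ n + w ^+ 2 + 1) + (w ^+ 4 + w)).
    by do 3?apply: absorbingD => //; apply: absorbingM.
  apply: (@eq_mod2 (- (w ^+ n) ^+ 2 - w ^+ n - w ^+ n * w ^+ 2 - w ^+ 2 - w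
                    - w ^+ 4)).
  by set p := w ^+ n; ring.
Qed.

Lemma absorbing_iter_phi m f : absorbing (iter m.+1 phi f) -> absorbing (phi f).
Proof. by elim: m => // m IHm /absorbing_phi. Qed.

Lemma exprD_2X a b i : (a + b) ^+ (2 ^ i) = a ^+ (2 ^ i) + b ^+ (2 ^ i) :> R.
Proof.
elim: i => [|i IHi]; first by rewrite !expr1.
rewrite expnSr !exprM IHi.
by apply: (@eq_mod2 (a ^+ (2 ^ i) * b ^+ (2 ^ i))); ring.
Qed.

Lemma phiD a b : phi (a + b) = phi a + phi b.
Proof. by rewrite /phi (exprD_2X a b 1) addrACA. Qed.

Definition trsum (D : nat) (f : R) : R := \sum_(i < D) f ^+ (2 ^ i).
Definition frobXD (D : nat) (f : R) : R := f ^+ (2 ^ D) + f.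

Lemma phi_trsum D f : phi (trsum D f) = frobXD D f.
Proof.
rewrite /trsum /frobXD; elim: D => [|D IHD].
  by rewrite big_ord0 /phi expr0n add0r expr1 addrr_pchar2.
rewrite big_ord_recr phiD IHD /phi /= -exprM -expnSr.
by apply: (@eq_mod2 (f ^+ (2 ^ D))); ring.
Qed.

Lemma trsum_phi D f : trsum D (phi f) = phi (trsum D f).
Proof.
rewrite /trsum; elim: D => [|D IHD].
  by rewrite !big_ord0 /phi expr0n addr0.
rewrite !big_ord_recr phiD IHD /=; congr (_ + _).
by rewrite /phi exprD_2X -!exprM mulnC.
Qed.

Lemma trsum_iter_phi D m f : trsum D (iter m phi f) = iter m phi (trsum D f).
Proof. by elim: m => //= m <-; rewrite trsum_phi. Qed.

Lemma iter_frobXD D m f : iter m (frobXD D) f = iter m phi (iter m (trsum D) f).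
Proof.
by elim: m => //= m ->; rewrite -phi_trsum trsum_iter_phi.
Qed.

(** In characteristic 2, sigma^(2E) - 1 = (sigma^E - 1)^2. *)
Lemma frobXD_double E f : frobXD (E + E) f = frobXD E (frobXD E f).
Proof.
rewrite /frobXD exprD_2X -exprM -expnD addrA; congr (_ + _).
by rewrite -addrA addrr_pchar2 // addr0.
Qed.

Lemma frobXD_pow2 D a f : frobXD (2 ^ a * D) f = iter (2 ^ a) (frobXD D) f.
Proof.
elim: a f => [|a IHa] f; first by rewrite expn0 mul1n.
by rewrite expnS mul2n -addnn mulnDl frobXD_double !IHa -iterD.
Qed.

Lemma H_frobX f i : H (f + f ^+ (2 ^ i)).
Proof.
elim: i => [|i IHi]; first by rewrite addrr_pchar2 //; exact: H_0.
rewrite (_ : _ + _ = (f + f ^+ (2 ^ i)) + (f ^+ (2 ^ i) + (f ^+ (2 ^ i)) ^+ 2)).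
  by apply: HD => //; apply: H_frob.
by rewrite expnSr exprM; apply: (@eq_mod2 (- (f ^+ (2 ^ i)))); ring.
Qed.

(** Each of the D terms of the trace is congruent to f modulo H, and D f = f for D odd. *)
Lemma H_trsum D f : odd D -> H (trsum D f + f).
Proof.
move=> oD; have eD : f = f *+ D.
  rewrite -[D]odd_double_half oD mulrnDr -mul2n mulrnA -[f *+ 2]mulr_natl.
  by rewrite two0 mul0r mul0rn addr0.
rewrite {2}eD; elim: D {oD eD} => [|D IHD].
  by rewrite /trsum big_ord0 addr0; exact: H_0.
rewrite /trsum big_ord_recr mulrSr addrACA; apply: HD => //.
by rewrite addrC; apply: H_frobX.
Qed.

(* Some Frobenius power [y] of [x] satisfies [sigma^E y = y] modulo the ideal.
   Write [E = 2^a * D] with [D] odd: then [phi] and [trsum D] composed [2^a]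
   times each annihilate [y], so [z], the iterated [trsum D] of [y], is killed
   by a power of [phi], hence by [phi] itself, i.e. it is idempotent.  Thus
   [z = z ^+ n.*2] is in [H], and [z = y = x] modulo [H] because [D] is odd. *)
Lemma pow_frob_closed_full x : H x.
Proof.
have [|n' cn' def_n] := @pfactor_coprime 2 n _ n_gt0; first by [].
have n'_gt0 : (0 < n')%N by case: n' def_n n_gt0 {cn'} => // ->; rewrite mul0n.
pose y := x ^+ (2 ^ n).
pose E := totient n'.
have IE : absorbing (frobXD E y).
  (* The factor 2^n absorbs the 2-part of n, and Euler's theorem handles the odd part n'. *)
  have [j ej] : exists j, (2 ^ n * (2 ^ E).-1 = n * j)%N.
    suff /dvdnP[j ->] : (n %| 2 ^ n * (2 ^ E).-1)%N by exists j; rewrite mulnC.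
    rewrite {1}def_n mulnC dvdn_mul //.
      by apply: dvdn_exp2l; apply: ltnW; apply: ltn_logl.
    rewrite -subn1 -eqn_mod_dvd ?expn_gt0 //; apply/eqP.
    exact: Euler_exp_totient.
  have le_n : (n.-1 <= 2 ^ n)%N.
    by apply: leq_trans (leq_pred n) (ltnW _); apply: ltn_expl.
  have Ij i : absorbing (x ^+ n.-1 * (x ^+ (n * i) + 1)).
    elim: i => [|i IHi].
      by rewrite muln0 expr0 addrr_pchar2 // mulr0; exact: absorbing0.
    rewrite (_ : _ * _ = x ^+ n.-1 * (x ^+ (n * i) + 1) * x ^+ n
                       + x ^+ n.-1 * (x ^+ n + 1)).
      by apply: absorbingD; [apply: absorbingM | apply: absorbing_pow].
    apply: (@eq_mod2 (- x ^+ n.-1 * x ^+ n)); rewrite mulnS exprD.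
    by set p := x ^+ n; set q := x ^+ n.-1; ring.
  (* This is y (y^(2^E - 1) + 1) with y = x^(2^n); the factor x^(n-1) can be split off since n - 1
     <= 2^n. *)
  rewrite (_ : frobXD E y =
             x ^+ n.-1 * (x ^+ (n * j) + 1) * x ^+ (2 ^ n - n.-1)).
    exact: absorbingM.
  rewrite mulrAC -exprD subnKC // mulrDr mulr1 /frobXD -ej -exprM -exprD.
  by rewrite -mulnS prednK // expn_gt0.
have E_gt0 : (0 < E)%N by rewrite totient_gt0.
have [|D cD def_E] := @pfactor_coprime 2 E _ E_gt0; first by [].
rewrite def_E mulnC frobXD_pow2 iter_frobXD in IE.
set z := iter _ (trsum D) y in IE.
have {}IE : absorbing (phi z).
  move: IE; rewrite -(prednK (n := 2 ^ _)) ?expn_gt0 //.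
  exact: absorbing_iter_phi.
have Hzy : H (y + z).
  rewrite /z; elim: (2 ^ _)%N => [|m IHm] /=.
    by rewrite addrr_pchar2 //; exact: H_0.
  set u := iter m _ y in IHm *.
  rewrite (_ : y + trsum D u = (y + u) + (trsum D u + u)).
    by apply: HD => //; apply: H_trsum; rewrite -coprime2n.
  by apply: (@eq_mod2 (- u)); ring.
have Iz j : absorbing (z + z ^+ j.+1).
  elim: j => [|j IHj]; first by rewrite addrr_pchar2 //; exact: absorbing0.
  rewrite (_ : _ + _ = (z + z ^+ j.+1) * z + phi z).
    by apply: absorbingD => //; apply: absorbingM.
  by rewrite /phi; apply: (@eq_mod2 (- z ^+ 2)); rewrite !exprS; ring.
have Hz : H z.
  apply: (H_congr (b := z ^+ n.*2)) => //.
  have e : n.*2 = n.*2.-1.+1 by rewrite prednK // double_gt0.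
  by rewrite e; apply: H_absorbing; apply: Iz.
by apply: (H_congr (b := y)); [apply: H_frobX | apply: (H_congr (b := z))].
Qed.

End CharTwo.

(** * Reduction modulo 2, and the upper bound when 3 does not divide k *)

Lemma map_poly_intr_F2_surj (p : {poly 'F_2}) :
  exists f : {poly int}, map_poly intr f = p.
Proof.
exists (\poly_(i < size p) (nat_of_ord (p`_i : 'F_2))%:Z).
apply/polyP => i; rewrite coef_map coef_poly /=.
have [_|le_p_i] := ltnP i (size p); last by rewrite nth_default.
by rewrite -pmulrn natr_Zp.
Qed.

Lemma map_poly_intr_F2_eq0 (f : {poly int}) :
  map_poly (intr : int -> 'F_2) f = 0 -> exists g, f = 2 * g.
Proof.
move=> f0; exists (\poly_(i < size f) (f`_i %/ 2)%Z).
apply/polyP => i; rewrite mulr_natl coefMn coef_poly.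
have [_|le_f_i] := ltnP i (size f); last by rewrite nth_default // mul0rn.
have : (f`_i)%:~R = 0 :> 'F_2 by rewrite -(coef_map intr) /= f0 coef0.
move/eqP; rewrite -(@dvdz_pcharf _ 2) ?pchar_Fp // => /divzK {1}<-.
by set y := (_ %/ _)%Z; lia.
Qed.

Lemma in_J2_mul_pow2_coprime3 (k : nat) (a : {poly int}) :
  (0 < k)%N -> ~~ odd k -> ~~ (3 %| k)%N -> in_J2 k (2 ^+ (logn 2 k).+1 * a).
Proof.
move=> k_gt0 ev k3; set v := logn 2 k.
pose n := k./2.
have ek : k = n.*2 by rewrite -[LHS]odd_double_half (negPf ev).
have n_gt0 : (0 < n)%N by move: k_gt0; rewrite ek double_gt0.
have ev1 : v = (logn 2 n).+1 by rewrite /v ek -mul2n lognM.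
pose H (p : {poly 'F_2}) :=
  exists2 g : {poly int}, map_poly intr g = p & in_J2 k (2 ^+ v.+1 * g).
(* The choice of lift is immaterial: two lifts differ by some 2b, and 2^(v+2) b is in the localized
   J. *)
suff [g eg Jg] : H (map_poly intr a).
  have [|b eb] := @map_poly_intr_F2_eq0 (a - g).
    by rewrite rmorphB /= eg subrr.
  rewrite -[a](subrK g) eb mulrDr mulrA -exprSr.
  by apply: in_J2D => //; apply: in_J2_mul_pow2.
apply: (@pow_frob_closed_full _ n H).
- by rewrite pchar_poly pchar_Fp.
- by [].
- by apply: contra k3; rewrite ek -mul2n; apply: dvdn_mull.
- move=> _ _ [g1 <- Jg1] [g2 <- Jg2]; exists (g1 + g2); rewrite ?rmorphD //.
  by rewrite mulrDr; apply: in_J2D.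
- move=> p; have [f <-] := map_poly_intr_F2_surj p.
  exists (f ^+ k); first by rewrite rmorphXn /= ek.
  by rewrite -natrX mulr_natl; apply: in_J2Mn; apply: in_J2X.
move=> p1 p2; have [f <-] := map_poly_intr_F2_surj p1.
have [g <-] := map_poly_intr_F2_surj p2.
exists (f ^+ n.*2.-1 * g + f ^+ n.*2.-2 * g ^+ 2).
  by rewrite rmorphD !rmorphM !rmorphXn.
(* The perturbation 2g is too large for this expansion, but (f + 2g)^2 = f^2 + 4(fg + g^2), so it
   applies to the n-th power of the square. *)
have [W EW] := exprD_mul_pow2 (f ^+ 2) (f * g + g ^+ 2) (isT : 1 < 2)%N n_gt0.
rewrite (_ : _ * _ = (f + 2 * g) ^+ k - f ^+ k - 2 ^+ v.+2 * W).
  by apply: in_J2B; [apply: in_J2B; apply: in_J2X | apply: in_J2_mul_pow2].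
rewrite ek -mul2n !exprM.
rewrite (_ : (f + 2 * g) ^+ 2 = f ^+ 2 + 2 ^+ 2 * (f * g + g ^+ 2)).
  rewrite EW !add2n -ev1 mul2n.
  case: (n) n_gt0 => // m _ /=.
  rewrite -mul2n (exprS f) exprM; set F := (f ^+ 2) ^+ m.
  rewrite !(exprS 2).
  by ring.
by ring.
Qed.

(** * Lower bounds from quotients by monic quadratics *)

Lemma modp_quadratic (q f : {poly int}) : q \is monic -> size q = 3 ->
  exists a b h, f = a%:P + b%:P * 'X + q * h.
Proof.
move=> qm sq; have q0 : q != 0 by rewrite -size_poly_gt0 sq.
exists (f %% q)`_0, (f %% q)`_1, (f %/ q).
rewrite [LHS](Pdiv.IdomainMonic.divp_eq qm) addrC mulrC; congr (_ + _).
have := ltn_modp f q; rewrite q0 sq ltnS => sf.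
apply/polyP => -[|[|i]]; rewrite coefD coefC coefMX coefC ?addr0 ?add0r //.
by rewrite /= nth_default // (leq_trans sf).
Qed.

(** The preimage in Z[x] of the subring Z + 2^e Z[x]/(q). *)
Definition int_mod (q : {poly int}) (e : nat) (f : {poly int}) :=
  exists (n : int) g h, f = n%:P + 2 ^+ e * g + q * h.

(** Every polynomial is congruent to some a + b x modulo q, so the subgroup [int_mod q e] contains
    all kth powers, hence J. The class of m x lies in Z + 2^e Z[x]/(q) only if 2^e divides m,
    because 1 and x form a basis. *)
Lemma dvdn_in_J_mulXn (q : {poly int}) (k e m : nat) :
  q \is monic -> size q = 3 -> (0 < k)%N ->
  (forall a b : int, int_mod q e ((a%:P + b%:P * 'X) ^+ k)) ->
  in_J k ('X *+ m : {poly int}) -> (2 ^ e %| m)%N.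
Proof.
move=> qm sq k_gt0 Sk /in_JP => /(_ (int_mod q e)) [].
- by exists 0, 0, 0; rewrite !mulr0 !addr0.
- move=> _ _ [n [g [h ->]]] [n' [g' [h' ->]]].
  by exists (n - n'), (g - g'), (h - h'); rewrite polyCB; ring.
- move=> f; have [a [b [h ->]]] := modp_quadratic f qm sq.
  have [n [g [h' E]]] := Sk a b.
  case: k k_gt0 {Sk} E => // k _ E.
  have [W ->] := exprD_linear (a%:P + b%:P * 'X) (q * h) k.
  rewrite E; exists n, g.
  exists (h' + k.+1%:R * (a%:P + b%:P * 'X) ^+ k * h + q * h ^+ 2 * W).
  by ring.
move=> n [g [h E]]; have [a [b [h' eg]]] := modp_quadratic g qm sq.
(* [r] is a multiple of the quadratic q of degree below 2, hence 0; its coefficient of x gives the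
   divisibility. *)
pose r : {poly int} := (- n - 2 ^+ e * a)%:P + (m%:Z - 2 ^+ e * b)%:P * 'X.
have er : r = q * (h + 2 ^+ e * h').
  rewrite /r !(polyCB, polyCN, polyCM) rmorphXn /= polyC_natr.
  have -> : (m%:Z)%:P = m%:R :> {poly int} by rewrite -natz polyC_natr.
  rewrite -(mulr_natl 'X m) eg in E; rewrite mulrBl E.
  by ring.
have r0 : r = 0.
  apply/eqP/negPn/negP => nz_r.
  have : (size r <= 2)%N.
    rewrite (leq_trans (size_polyD _ _)) // geq_max.
    rewrite (leq_trans (size_polyC_leq1 _)) //=.
    have [->|nz] := eqVneq (m%:Z - 2 ^+ e * b) 0.
      by rewrite mul0r size_poly0.
    by rewrite size_mulX ?polyC_eq0 // size_polyC nz.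
  have nz : h + 2 ^+ e * h' != 0.
    by move: nz_r; rewrite er; apply: contraNneq => ->; rewrite mulr0.
  rewrite er size_monicM // sq; move: nz; rewrite -size_poly_gt0.
  by case: (size _).
have := congr1 (fun p : {poly int} => p`_1) r0.
rewrite /r coefD coefMX !coefC /= add0r => /subr0_eq em.
have : (2 ^+ e %| m%:Z)%Z by rewrite em dvdz_mulr.
by rewrite dvdzE abszX.
Qed.

Lemma int_mod_exprM (q r g h : {poly int}) (j k n : nat) (c : int) :
  (1 < j)%N -> (0 < n)%N -> r ^+ k = c%:P + 2 ^+ j * g + q * h ->
  int_mod q (j + logn 2 n) (r ^+ (k * n)).
Proof.
move=> j1 n_gt0 E; rewrite exprM E.
have [W EW] := exprD_mul_pow2 c%:P g j1 n_gt0.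
case: n n_gt0 EW => // n _ EW.
have [W' ->] := exprD_linear (c%:P + 2 ^+ j * g) (q * h) n.
rewrite EW; set l := (_ + logn _ _)%N.
exists (c ^+ n.+1), (c%:P ^+ n * g + 2 * W),
  (n.+1%:R * (c%:P + 2 ^+ j * g) ^+ n * h + q * h ^+ 2 * W').
rewrite rmorphXn /= (exprS 2 l).
by ring.
Qed.

Lemma int_parity (x : int) : exists y, x = 2 * y \/ x = 2 * y + 1.
Proof. by exists (x %/ 2)%Z; lia. Qed.

(** The two factors have an odd sum, so one of them is even. *)
Lemma even_mulB (t s : int) : exists d, t * (2 * s + 1 - t) = 2 * d.
Proof.
have [u [->|->]] := int_parity t.
  by exists (u * (2 * s + 1 - 2 * u)); ring.
by exists ((2 * u + 1) * (s - u)); ring.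
Qed.

(** The imaginary part of (a + bi)^4 is four times this product, hence divisible by 8. *)
Lemma gauss_even (a b : int) : exists d, a * b * (a ^+ 2 - b ^+ 2) = 2 * d.
Proof.
have [x [->|->]] := int_parity a.
  by eexists; rewrite -!mulrA; reflexivity.
have [y [->|->]] := int_parity b.
  by exists ((2 * x + 1) * y * ((2 * x + 1) ^+ 2 - (2 * y) ^+ 2)); ring.
exists ((2 * x + 1) * (2 * y + 1) * (2 * (x ^+ 2 + x - y ^+ 2 - y))); ring.
Qed.

(* [(a + b w)^3 = s + t w] for [w] a primitive cube root of unity, and the
   coefficient of [w] in its square is [t (2 s - t)]. *)
Lemma eisenstein_dvd8 (a b : int) :
  let t := 3 * a * b * (a - b) in
  let s := a ^+ 3 + b ^+ 3 - 3 * a * b ^+ 2 in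
  exists d, t * (2 * s - t) = 8 * d.
Proof.
move=> t s.
(* If a and b are both even, then 8 divides t. Otherwise t = 2t' is even and s = 2s' + 1 is odd, and
   the product is 4 t' (2s' + 1 - t'). *)
suff H (t' s' : int) : t = 2 * t' -> s = 2 * s' + 1 ->
    exists d, t * (2 * s - t) = 8 * d.
  rewrite /t /s in H *.
  have [x [ea|ea]] := int_parity a; have [y [eb|eb]] := int_parity b.
  - rewrite ea eb; set u := 2 * (_ - _) - _.
    by exists (3 * x * y * (x - y) * u); rewrite /u; ring.
  - apply: (H (3 * x * b * (a - b))
      (4 * x ^+ 3 + 4 * y ^+ 3 + 6 * y ^+ 2 + 3 * y - 3 * x * b ^+ 2));
      rewrite ea eb; ring.
  - apply: (H (3 * y * a * (a - b))
      (4 * x ^+ 3 + 4 * y ^+ 3 + 6 * x ^+ 2 + 3 * x - 6 * a * y ^+ 2));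
      rewrite ea eb; ring.
  - apply: (H (3 * a * b * (x - y))
      (4 * x ^+ 3 + 6 * x ^+ 2 + 4 * y ^+ 3 - 3 * y
         - 12 * x * y ^+ 2 - 12 * x * y - 1));
      rewrite ea eb; ring.
move=> -> ->; have [d ed] := even_mulB t' s'; exists d.
have -> : 8 * d = 4 * (2 * d) by ring.
by rewrite -ed; ring.
Qed.

(** If k = 4n, fourth powers have imaginary part divisible by 8, and the n-th power adds the
    valuation of n, which is v - 2. *)
Lemma int_mod_gauss (k : nat) (a b : int) : (2 < k)%N -> ~~ odd k ->
  int_mod ('X^2 + 1) (logn 2 k).+1 ((a%:P + b%:P * 'X) ^+ k).
Proof.
move=> k_gt2 ev; set q : {poly int} := 'X^2 + 1.
have eX : 'X ^+ 2 = q - 1 by rewrite /q addrK.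
have [k4|k4] := boolP (4 %| k)%N.
  have [n ek] := dvdnP k4.
  have n_gt0 : (0 < n)%N by move: k_gt2; rewrite ek; case: (n).
  have -> : (logn 2 k).+1 = (3 + logn 2 n)%N.
    by rewrite ek lognM // (lognX 2 2 2) addnC.
  rewrite ek mulnC; have [d ed] := gauss_even a b.
  have edP : a%:P * b%:P * (a%:P ^+ 2 - b%:P ^+ 2) = 2 * d%:P :> {poly int}.
    by rewrite -!rmorphXn -rmorphB -!rmorphM /= ed rmorphM rmorph_nat.
  set A := a%:P in edP *; set B := b%:P in edP *; set D := d%:P in edP.
  apply: (@int_mod_exprM q _ (D * 'X)
    (B ^+ 2 * (2 * (A ^+ 2 - B ^+ 2 + 2 * A * B * 'X) + q * B ^+ 2)
       + 4 * A ^+ 2 * B ^+ 2)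
    3 4 n ((a ^+ 2 - b ^+ 2) ^+ 2 - 4 * a ^+ 2 * b ^+ 2)) => //.
  rewrite !(rmorphB, rmorphM, rmorphXn, rmorph_nat) /= -/A -/B.
  rewrite (_ : 2 ^+ 3 * (D * 'X) = 4 * (2 * D) * 'X); last by ring.
  rewrite -edP.
  have -> : (A + B * 'X) ^+ 4 =
    (A ^+ 2 + 2 * A * B * 'X + B ^+ 2 * 'X ^+ 2) ^+ 2 by ring.
  rewrite eX.
  have -> : (A ^+ 2 + 2 * A * B * 'X + B ^+ 2 * (q - 1)) ^+ 2 =
    (A ^+ 2 - B ^+ 2) ^+ 2 + 4 * (A * B * (A ^+ 2 - B ^+ 2)) * 'X
    + 4 * A ^+ 2 * B ^+ 2 * 'X ^+ 2
    + q * (B ^+ 2 * (2 * (A ^+ 2 - B ^+ 2 + 2 * A * B * 'X) + q * B ^+ 2)).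
    by ring.
  by rewrite eX; ring.
(* Now k = 2n with n odd and v = 1. Put C = a^2 - b^2, so that (a + bi)^2 = C + 2abi. As n > 1, the
   linear term of the n-th power contains 2abC, a multiple of 4; the later terms contain (2ab)^2. *)
have [n ek] : exists n, k = (2 * n)%N.
  by exists k./2; rewrite mul2n -[LHS]odd_double_half (negPf ev).
have odd_n : odd n.
  by apply: contraR k4; rewrite ek -dvdn2 => n2; apply: (@dvdn_mul 2 2).
have -> : (logn 2 k).+1 = 2.
  have [|n_gt0] := posnP n; first by move=> n0; rewrite n0 in odd_n.
  by rewrite ek lognM // [logn 2 n]lognE dvdn2 odd_n andbF.
have n_gt1 : (1 < n)%N by rewrite ek in k_gt2; lia.
rewrite ek exprM; case: n n_gt1 {ek odd_n} => [|[|n]] // _.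
set A := a%:P; set B := b%:P.
have -> : (A + B * 'X) ^+ 2 =
    A ^+ 2 + 2 * A * B * 'X + B ^+ 2 * 'X ^+ 2 by ring.
rewrite eX.
have [d ed] := gauss_even a b.
have edP : A * B * (A ^+ 2 - B ^+ 2) = 2 * d%:P :> {poly int}.
  by rewrite -!rmorphXn -rmorphB -!rmorphM /= ed rmorphM rmorph_nat.
set D := d%:P in edP; set C := A ^+ 2 - B ^+ 2 in edP.
have [W E] := exprD_linear C (2 * A * B * 'X) n.+1.
have [W' E'] := exprD_linear (C + 2 * A * B * 'X) (q * B ^+ 2) n.+1.
exists ((a ^+ 2 - b ^+ 2) ^+ n.+2),
  (n.+2%:R * C ^+ n * D * 'X + A ^+ 2 * B ^+ 2 * 'X ^+ 2 * W),
  (n.+2%:R * (C + 2 * A * B * 'X) ^+ n.+1 * B ^+ 2 + q * B ^+ 4 * W').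
rewrite (_ : _ + _ * (q - 1) = (C + 2 * A * B * 'X) + q * B ^+ 2); last first.
  by rewrite /C; ring.
have -> : ((a ^+ 2 - b ^+ 2) ^+ n.+2)%:P = C ^+ n.+2.
  by rewrite rmorphXn rmorphB !rmorphXn.
rewrite E' E.
have -> : n.+2%:R * C ^+ n.+1 * (2 * A * B * 'X) =
    n.+2%:R * C ^+ n * 2 * (A * B * C) * 'X by rewrite exprS; ring.
by rewrite edP; ring.
Qed.

(** With k = 6n, sixth powers have w-coefficient divisible by 8, and the n-th power adds the
    valuation of n, which is v - 1. *)
Lemma int_mod_eisenstein (k : nat) (a b : int) : (0 < k)%N -> (6 %| k)%N ->
  int_mod ('X^2 + 'X + 1) (logn 2 k).+2 ((a%:P + b%:P * 'X) ^+ k).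
Proof.
move=> k_gt0 k6; set q : {poly int} := 'X^2 + 'X + 1.
have eX : 'X ^+ 2 = q - 'X - 1 by rewrite /q; ring.
have [n ek] := dvdnP k6.
have n_gt0 : (0 < n)%N by move: k_gt0; rewrite ek; case: (n).
have -> : (logn 2 k).+2 = (3 + logn 2 n)%N.
  by rewrite ek lognM // (_ : logn 2 6 = 1) // addn1.
rewrite ek mulnC.
have [d] := eisenstein_dvd8 a b.
set t := 3 * a * b * (a - b); set s := a ^+ 3 + _ - _ => ed.
have edP : t%:P * (2 * s%:P - t%:P) = 8 * d%:P :> {poly int}.
  move: t s ed => t s /(congr1 (polyC (R := int))).
  by rewrite !(rmorphM, rmorphB, rmorph_nat).
pose h := 3 * a%:P * b%:P ^+ 2 + b%:P ^+ 3 * ('X - 1) : {poly int}.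
have E3 : (a%:P + b%:P * 'X) ^+ 3 = s%:P + t%:P * 'X + q * h.
  rewrite /s /t /h !(rmorphB, rmorphD, rmorphM, rmorphXn, rmorph_nat) /= /q.
  by ring.
clearbody t s h.
(* Since w^2 = -1 - w, the square of s + t w is s^2 - t^2 + t (2s - t) w. *)
apply: (@int_mod_exprM q _ (d%:P * 'X)
  (t%:P ^+ 2 + h * (2 * (s%:P + t%:P * 'X) + q * h))
  3 6 n (s ^+ 2 - t ^+ 2)) => //.
rewrite (exprM _ 3 2) E3 !(rmorphB, rmorphXn) /=.
rewrite (_ : 2 ^+ 3 * (d%:P * 'X) = 8 * d%:P * 'X); last by ring.
rewrite -edP.
have -> : (s%:P + t%:P * 'X + q * h) ^+ 2 = s%:P ^+ 2 + 2 * s%:P * t%:P * 'X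
   + t%:P ^+ 2 * 'X ^+ 2 + q * h * (2 * (s%:P + t%:P * 'X) + q * h) by ring.
by rewrite eX; ring.
Qed.

(** * The 2-adic valuation of m(k) *)

Lemma logn2_mk (k e : nat) : (0 < k)%N ->
  (forall m, in_J k ('X *+ m : {poly int}) -> (2 ^ e %| m)%N) ->
  in_J2 k (2 ^+ e * 'X) -> logn 2 (mk k) = e.
Proof.
move=> k_gt0 dvd_e [c oc Jc]; have [[M_gt0 JM] minM] := mkP k_gt0.
set M := mk k in M_gt0 JM minM *.
have c_gt0 : (0 < c)%N by case: c oc {Jc}.
have {}Jc : in_J k ('X *+ (2 ^ e * c) : {poly int}).
  by rewrite mulrnA -[X in X *+ c]mulr_natl natrX.
(* The integers m with m x in J form a group, so its least positive element divides all others; as c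
   is odd, this bounds the valuation by e. *)
have dvdM : (M %| 2 ^ e * c)%N.
  rewrite /dvdn -leqn0 leqNgt; apply/negP => r_gt0.
  have := ltn_pmod (2 ^ e * c) M_gt0; rewrite ltnNge => /negP[].
  apply: minM; split=> //.
  rewrite (_ : 'X *+ _ = 'X *+ (2 ^ e * c) - 'X *+ M *+ (2 ^ e * c %/ M)).
    by apply: in_JB => //; apply: in_JMn.
  rewrite {2}(divn_eq (2 ^ e * c) M) mulrnDr [(_ * M)%N]mulnC -mulrnA.
  by rewrite addrAC subrr add0r.
apply/eqP; rewrite eqn_leq; apply/andP; split.
  have := dvdn_leq_log 2 _ dvdM; rewrite muln_gt0 expn_gt0 c_gt0 => /(_ isT).
  rewrite lognM ?expn_gt0 // pfactorK //.
  by rewrite [logn 2 c]lognE dvdn2 oc /= andbF addn0.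
by have := dvdn_leq_log 2 M_gt0 (dvd_e _ JM); rewrite pfactorK.
Qed.

Lemma monic_size_quadratic (a b : int) (q := 'X^2 + a%:P * 'X + b%:P) :
  (q \is monic) && (size q == 3).
Proof.
have sq : size q = 3.
  rewrite /q -addrA size_polyDl ?size_polyXn //.
  rewrite (leq_ltn_trans (size_polyD _ _)) // gtn_max; apply/andP; split.
    rewrite mul_polyC (leq_ltn_trans (size_scale_leq _ _)) //.
    by rewrite size_polyX.
  by rewrite (leq_ltn_trans (size_polyC_leq1 _)).
rewrite sq eqxx andbT monicE /lead_coef sq /q.
by rewrite !coefD coefXn coefMX !coefC /= !addr0.
Qed.

Theorem theorem1 :
  alpha 2 2 = 0 /\
  (forall k : nat, (2 < k)%N -> ~~ odd k ->
     alpha k 2 = if (6 %| k)%N then 2 else 1).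
Proof.
pose qi : {poly int} := 'X^2 + 1; pose qw : {poly int} := 'X^2 + 'X + 1.
have [mi si] : qi \is monic /\ size qi = 3.
  have /andP[] := monic_size_quadratic 0 1; rewrite mul0r addr0.
  by move=> ? /eqP.
have [mw sw] : qw \is monic /\ size qw = 3.
  have /andP[] := monic_size_quadratic 1 1; rewrite mul1r.
  by move=> ? /eqP.
split.
  (* For k = 2, squares in Z[i] have even imaginary part, while 2x = (x + 1)^2 - x^2 - 1. *)
  rewrite /alpha (@logn2_mk 2 1) //.
    move=> m; apply: (dvdn_in_J_mulXn (q := qi)) => // a b.
    exists (a ^+ 2 - b ^+ 2), (a%:P * b%:P * 'X), (b%:P ^+ 2).
    by rewrite /qi !(rmorphB, rmorphXn) /=; ring.
  rewrite (_ : 2 ^+ 1 * 'X = ('X + 1) ^+ 2 - 'X ^+ 2 - 1 ^+ 2); last by ring.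
  by apply: in_J2B; [apply: in_J2B|]; apply: in_J2X.
move=> k k_gt2 ev; have k_gt0 : (0 < k)%N by apply: ltn_trans k_gt2.
rewrite /alpha; case: ifPn => k6.
  rewrite (@logn2_mk k (logn 2 k).+2) //; first by lia.
    move=> m; apply: (dvdn_in_J_mulXn (q := qw)) => // a b.
    exact: int_mod_eisenstein.
  exact: in_J2_mul_pow2.
rewrite (@logn2_mk k (logn 2 k).+1) //; first by lia.
  move=> m; apply: (dvdn_in_J_mulXn (q := qi)) => // a b.
  exact: int_mod_gauss.
apply: in_J2_mul_pow2_coprime3 => //.
by apply: contra k6 => k3; rewrite (@Gauss_dvd 2 3) // k3 dvdn2 ev.
Qed.
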